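(* Let $\lambda>0$ and let $Y_1, Y_2, \ldots$ be i.i.d. random variables with the Poisson$(\lambda)$ distribution. For $n\ge 1$ let $\bar{Y}_n = n^{-1}\sum_{i=1}^n Y_i$. Then for any $\nu_{\max}>0$, with probability $1$, for all large enough $n$ the maximum likelihood estimate of $(\nu,p)$ for a negative binomial distribution NB$(\nu,p)$, based on the data $Y_1,\ldots,Y_n$ and under the constraint $0<\nu\le \nu_{\max}$ (and $p\in(0,1]$), is $$\left(\nu_{\max},\ \frac{\nu_{\max}}{\nu_{\max}+\bar{Y}_n}\right).$$
   Context: Poisson$(\lambda)$ has probability mass function $f_\lambda(y)=\frac{\lambda^y}{y!}e^{-\lambda}$, $y=0,1,2,\ldots$. For $\nu>0$ and $p\in(0,1)$, NB$(\nu,p)$ is the distribution on $\{0,1,2,\ldots\}$ with probability mass function $$f_{(\nu,p)}(y)=\frac{\Gamma(\nu+y)}{\Gamma(\nu)\Gamma(y+1)}\,p^\nu(1-p)^y .$$ For $p=1$ (any $\nu>0$) the distribution is the degenerate one putting mass $1$ at $0$. Given nonnegative integer data $Y_1,\ldots,Y_n$, a maximum likelihood estimate (MLE) of $(\nu,p)$ under the constraint $0<\nu\le\nu_{\max}$ is a maximizer $(\hat\nu,\hat p)$ of the likelihood $\prod_{i=1}^n f_{(\nu,p)}(Y_i)$ over $(\nu,p)\in(0,\nu_{\max}]\times(0,1]$. ''With probability 1, ... for all large enough $n$'' means that for almost every $\omega$ there is $N(\omega)$ such that the assertion holds for all $n\ge N(\omega)$. *)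

(* Defs.v *)
From HB Require Import structures.
From mathcomp Require Export all_boot all_order all_algebra finmap.
From mathcomp Require Export all_classical all_reals all_analysis.

Set Implicit Arguments.
Unset Strict Implicit.
Unset Printing Implicit Defensive.

Import Order.TTheory GRing.Theory Num.Theory.
Import numFieldNormedType.Exports.

Local Open Scope classical_set_scope.
Local Open Scope ring_scope.

Definition mutually_independent d d' (T : measurableType d)
    (T' : measurableType d') (R : realType) (P : probability T R)
    (X : nat -> {RV P >-> T'}) : Prop :=
  forall (J : {fset nat}) (A : nat -> set T'),
    (forall i, i \in J -> measurable (A i)) ->
    (P (\bigcap_(i in [set` J]) (X i @^-1` A i)) =
     \prod_(i <- J) P (X i @^-1` A i))%E.

Definition has_pmf d (T : measurableType d) (R : realType)
    (P : probability T R) (X : {RV P >-> nat}) (f : nat -> R) : Prop :=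
  forall k : nat, distribution P X [set k] = (f k)%:E.

(* Only meaningful for 0 < z, where the integral converges. *)
Definition Gamma {R : realType} (z : R) : R :=
  \int[lebesgue_measure]_(t in `]0, +oo[) (t `^ (z - 1) * expR (- t)).

(* The case p = 1 is the point mass at 0. *)
Definition nb_pmf {R : realType} (nu p : R) (y : nat) : R :=
  if p == 1 then (y == 0%N)%:R
  else Gamma (nu + y%:R) / (Gamma nu * Gamma (y%:R + 1))
       * p `^ nu * (1 - p) ^+ y.

Definition nb_likelihood {R : realType} (n : nat) (y : 'I_n -> nat)
    (theta : R * R) : R :=
  \prod_(i < n) nb_pmf theta.1 theta.2 (y i).

Definition nb_param {R : realType} (numax : R) : set (R * R) :=
  `]0, numax] `*` `]0, 1].

(* The set of all maximizers: the estimate need not exist or be unique. *)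
Definition nb_mle {R : realType} (numax : R) (n : nat) (y : 'I_n -> nat) :
    set (R * R) :=
  [set theta | nb_param numax theta /\
    forall theta', nb_param numax theta' ->
      nb_likelihood y theta' <= nb_likelihood y theta].

Definition sample_mean {R : realType} (n : nat) (y : 'I_n -> nat) : R :=
  n%:R^-1 * \sum_(i < n) (y i)%:R.

(* Main.v *)
Require Import Defs.
From mathcomp Require Import measurable_realfun.
From mathcomp Require Import ring lra.
Import Order.TTheory GRing.Theory Num.Theory.
Import numFieldNormedType.Exports.
Local Open Scope classical_set_scope.
Local Open Scope ring_scope.

(* For fixed nu the likelihood is maximal at p = nu / (nu + mean), and the
   derivative in nu of the profile log-likelihood per observation is
     sum_j #{i : Y_i > j} / n / (nu + j) - ln (1 + mean / nu).
   Its Poisson limit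
     g(lambda) = sum_j P(Y > j) / (nu + j) - ln (1 + lambda / nu)
   vanishes at lambda = 0 and, since d/dlambda P(Y > j) = P(Y = j), has
   derivative E[1 / (nu + Y)] - 1 / (nu + lambda), which is positive by Jensen's
   inequality. After multiplication by nu and truncation of the sum to j < K
   the positivity is uniform over 0 < nu <= numax, and it survives replacing the
   K + 1 quantities P(Y > j), lambda by empirical ones up to a small error. The
   latter is almost surely the case for large n by Chernoff bounds and the
   Borel-Cantelli lemma. The profile is then increasing on (0, numax]. *)

(** * The Gamma integral: finiteness, positivity, functional equation *)

Section gamma.
Context {R : realType}.
Implicit Types (x t : R).
Notation mu := (@lebesgue_measure R).

Definition gamma_integrand x t : R := t `^ (x - 1) * expR (- t).

Definition egamma x : \bar R :=
  (\int[mu]_(t in `]0%R, +oo[) (gamma_integrand x t)%:E)%E.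

(** A compact exhaustion of []0, +oo[]: integration by parts is carried out on these intervals, away
    from both endpoints. *)
Let I (n : nat) : interval R := `[n.+1%:R^-1, n.+1%:R].

Lemma gamma_integrand_ge0 x t : 0 <= gamma_integrand x t.
Proof. by rewrite mulr_ge0 ?powR_ge0 ?expR_ge0. Qed.

Lemma derivable_gamma_integrand x t : 0 < t ->
  derivable (gamma_integrand x) t 1.
Proof.
move=> t0; apply: derivableM.
  exact: (@ex_derive _ _ _ _ _ _ _ (is_derive1_powR (x - 1) t0)).
by apply: ex_derive.
Qed.

Lemma continuous_gamma_integrand x t : 0 < t ->
  {for t, continuous (gamma_integrand x)}.
Proof.
move=> t0; apply: differentiable_continuous; apply/derivable1_diffP.
exact: derivable_gamma_integrand.
Qed.

Lemma measurable_gamma_integrand x :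
  measurable_fun (`]0%R, +oo[%classic : set R) (EFin \o gamma_integrand x).
Proof.
apply/measurable_EFinP; apply: open_continuous_measurable_fun => //.
move=> t; rewrite inE/= in_itv/= andbT; exact: continuous_gamma_integrand.
Qed.

Let subI n : [set` I n] `<=` `]0%R, +oo[.
Proof.
move=> t/=; rewrite !in_itv/= andbT => /andP[+ _].
by apply: lt_le_trans; rewrite invr_gt0.
Qed.

Let bigcupI : \bigcup_n [set` I n] = `]0%R, +oo[%classic.
Proof.
apply/seteqP; split => [t [n _]|t/=]; first exact: subI.
rewrite in_itv/= andbT => t0.
exists (Num.truncn (t + t^-1)) => //=.
have tt : t + t^-1 <= (Num.truncn (t + t^-1)).+1%:R.
  by rewrite ltW// truncnS_gt.
rewrite in_itv/= -[t in _ <= t]invrK lef_pV2 ?posrE ?invr_gt0//.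
by rewrite !(le_trans _ tt)// ?lerDl ?lerDr ?invr_ge0 ltW.
Qed.

Let ndI : {homo (fun n => [set` I n]) : n m / (n <= m)%N >-> (n <= m)%O}.
Proof.
move=> n m nm; apply/subsetPset; apply: subset_itvScc; rewrite bnd_simp.
  by rewrite lef_pV2 ?posrE// ler_nat ltnS.
by rewrite ler_nat ltnS.
Qed.

Lemma egamma_cvg x :
  (\int[mu]_(t in [set` I n]) (gamma_integrand x t)%:E)%E @[n --> \oo]
   --> egamma x.
Proof.
rewrite /egamma -bigcupI; apply: ge0_nondecreasing_set_cvg_integral => //.
- by move=> n; apply: measurable_funS (measurable_gamma_integrand x).
- by move=> *; rewrite lee_fin gamma_integrand_ge0.
Qed.

Lemma gamma_integrand_parts x (a b : R) : 0 < x -> 0 < a -> a < b ->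
  (\int[mu]_(t in `[a, b]) (gamma_integrand (x + 1) t)%:E =
   (gamma_integrand (x + 1) a - gamma_integrand (x + 1) b)%:E +
   x%:E * \int[mu]_(t in `[a, b]) (gamma_integrand x t)%:E)%E.
Proof.
move=> x0 a0 ab.
have pos t : t \in `[a, b] -> 0 < t.
  by rewrite in_itv/= => /andP[+ _]; exact: lt_le_trans.
have pos' t : t \in `]a, b[ -> 0 < t.
  by rewrite in_itv/= => /andP[+ _]; exact: lt_trans.
have dpow (y t : R) : 0 < t -> derivable (fun t => t `^ y) t 1.
  by move=> t0; exact: (@ex_derive _ _ _ _ _ _ _ (is_derive1_powR y t0)).
have dexp t : is_derive t (1 : R) (fun t : R => - expR (- t)) (expR (- t)).
  by apply: is_derive_eq; rewrite mulrN1 opprK.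
have cexp : {within `[a, b], continuous (fun t : R => expR (- t))}.
  by apply: derivable_within_continuous => t _; apply: ex_derive.
have LR (F : R -> R) : (forall t, 0 < t -> derivable F t 1) ->
    derivable_oo_LRcontinuous F a b.
  move=> dF; have cF t : 0 < t -> {for t, continuous F}.
    by move=> t0; apply/differentiable_continuous/derivable1_diffP/dF.
  split; first by move=> t /pos'; exact: dF.
    exact/cvg_at_right_filter/cF.
  exact/cvg_at_left_filter/cF/(lt_trans a0 ab).
rewrite /gamma_integrand addrK.
rewrite (@integration_by_parts R (fun t => t `^ x) (fun t => - expR (- t))
   (fun t => x * t `^ (x - 1)) (fun t => expR (- t)) a b ab) //; last first.
- by move=> t _; rewrite derive1E; exact: (@derive_val _ _ _ _ _ _ _ (dexp t)).
- by apply: LR => t _; apply: ex_derive.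
- move=> t /pos' t0; rewrite derive1E.
  exact: (@derive_val _ _ _ _ _ _ _ (is_derive1_powR x t0)).
- by apply: LR => t; exact: dpow.
- by apply: derivable_within_continuous => t /pos t0; apply: derivableM => //;
  exact: dpow.
have -> : b `^ x * - expR (- b) - a `^ x * - expR (- a) =
    a `^ x * expR (- a) - b `^ x * expR (- b) by ring.
congr (_ + _)%E.
under eq_integral do rewrite mulrN -mulrA EFinN EFinM.
have ge0 t : (0 <= (t `^ (x - 1) * expR (- t))%:E)%E.
  by rewrite lee_fin mulr_ge0 ?powR_ge0 ?expR_ge0.
have mf : measurable_fun (`[a, b]%classic : set R)
    (fun t => (t `^ (x - 1) * expR (- t))%:E).
  apply: measurable_funS (measurable_gamma_integrand x) => // t /= /pos.
  by rewrite in_itv/= andbT.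
rewrite integral_ge0N; last by move=> t _; rewrite mule_ge0// lee_fin ltW.
by rewrite oppeK ge0_integralZl// lee_fin ltW.
Qed.

Lemma gamma_integrand_cvg0 x : 0 < x ->
  gamma_integrand (x + 1) n.+1%:R^-1 @[n --> \oo] --> (0 : R).
Proof.
move=> x0.
have h : n.+1%:R^-1 `^ x @[n --> \oo] --> (0 : R).
  have /cvg_at_rightP := @powR_cvg0 R x x0; apply; split=> [n|].
    by rewrite invr_gt0.
  exact: cvg_harmonic.
apply: (@squeeze_cvgr _ _ _ _ (cst 0) (fun n => n.+1%:R^-1 `^ x)) => //.
- apply: nearW => n; rewrite gamma_integrand_ge0/=.
  by rewrite /gamma_integrand addrK ler_piMr ?powR_ge0// expR_le1 oppr_le0.
- exact: cvg_cst.
Qed.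

Lemma gamma_integrand_cvgy x :
  gamma_integrand (x + 1) n.+1%:R @[n --> \oo] --> (0 : R).
Proof.
set m := (Num.truncn x).+1.
have xm : x <= m%:R by rewrite ltW// truncnS_gt.
apply: (@squeeze_cvgr _ _ _ _ (cst 0) (fun n => m.+1`!%:R * n.+1%:R^-1)) => //.
- apply: nearW => n; rewrite gamma_integrand_ge0/= /gamma_integrand addrK.
  rewrite expRN ler_pdivrMr ?expR_gt0//.
  apply: (@le_trans _ _ (n.+1%:R ^+ m)).
    by rewrite -powR_mulrn// ler_powR// ler1n.
  (* The exponential dominates its Taylor term of degree [m.+1], one more than the power to beat;
     this leaves a spare factor 1 / (n + 1). *)
  have := @expR_ge1Dxn R n.+1%:R m (ler0n _ _).
  rewrite -(ler_pM2l (_ : 0 < m.+1`!%:R * n.+1%:R^-1 :> R)); last first.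
    by rewrite divr_gt0// ltr0n fact_gt0.
  apply: le_trans; rewrite exprS mulrDr.
  rewrite mulr1 ler_wpDl ?divr_ge0//.
  have f0 : m.+1`!%:R != 0 :> R by rewrite pnatr_eq0 -lt0n fact_gt0.
  have n0 : n.+1%:R != 0 :> R by rewrite pnatr_eq0.
  move: n0 f0; move: (n.+1%:R : R) (m.+1`!%:R : R) => u v u0 v0.
  by rewrite le_eqVlt; apply/orP; left; apply/eqP; field; rewrite u0 v0.
- exact: cvg_cst.
- rewrite -[0](mulr0 m.+1`!%:R); apply: cvgM; first exact: cvg_cst.
  exact: cvg_harmonic.
Qed.

(** Integration by parts on [I n] in the limit: the boundary terms vanish at both ends. *)
Lemma egammaS x : 0 < x -> egamma (x + 1) = (x%:E * egamma x)%E.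
Proof.
move=> x0.
(* The index is shifted because [I 0] is the single point 1, whereas [gamma_integrand_parts]
   requires [a < b]. *)
have E n : (\int[mu]_(t in [set` I n.+1]) (gamma_integrand (x + 1) t)%:E =
    (gamma_integrand (x + 1) n.+2%:R^-1 - gamma_integrand (x + 1) n.+2%:R)%:E +
   x%:E * \int[mu]_(t in [set` I n.+1]) (gamma_integrand x t)%:E)%E.
  apply: gamma_integrand_parts => //.
  by rewrite (@lt_trans _ _ 1) ?invf_lt1 ?ltr1n.
have := egamma_cvg (x + 1); rewrite -cvg_shiftS/= (funext E).
move=> cg; apply: (cvg_unique _ cg) => //.
rewrite -[(x%:E * egamma x)%E]add0e.
apply: cvgeD.
- exact: fin_num_adde_defr.
- apply: cvg_EFin; first exact: nearW.
  rewrite -(subrr 0); apply: cvgB.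
    by have := gamma_integrand_cvg0 _ x0; rewrite -cvg_shiftS.
  by have := gamma_integrand_cvgy x; rewrite -cvg_shiftS.
- apply: cvgeZl => //; have := egamma_cvg x; by rewrite -cvg_shiftS.
Qed.

Lemma egamma1_lty : (egamma 1 < +oo)%E.
Proof.
rewrite /egamma; under eq_integral do
  rewrite /gamma_integrand subrr powRr0 mul1r.
have cexp (t : R) : {for t, continuous (fun t : R => expR (- t))}.
  have : derivable (fun t : R => expR (- t)) t 1 by apply: ex_derive.
  by move=> /derivable1_diffP/differentiable_continuous.
rewrite integral_itv_obnd_cbnd; last first.
  apply/measurable_EFinP; apply: open_continuous_measurable_fun => // t _.
  exact: cexp.
have dexp (t : R) : is_derive t 1 (fun t : R => - expR (- t)) (expR (- t)).
  by apply: is_derive_eq; rewrite mulrN1 opprK.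
rewrite (@ge0_continuous_FTC2y R _ (fun t => - expR (- t)) _ 0).
- by rewrite ltry.
- by move=> *; exact: expR_ge0.
- by apply: continuous_subspaceT => t; exact: cexp.
- by rewrite -oppr0; apply: cvgN; exact: cvgr_expR.
- by move=> t _; exact: (@ex_derive _ _ _ _ _ _ _ (dexp t)).
- apply: cvgN; apply: cvg_at_right_filter; exact: cexp.
- by move=> t _; rewrite derive1E (@derive_val _ _ _ _ _ _ _ (dexp t)).
Qed.

Lemma egamma_nat_lty (m : nat) : (egamma m.+1%:R < +oo)%E.
Proof.
elim: m => [|m ih]; first exact: egamma1_lty.
by rewrite -[m.+2%:R]natr1 egammaS// lte_mul_pinfty// lee_fin.
Qed.

Lemma egamma_ge0 x : (0 <= egamma x)%E.
Proof. by apply: integral_ge0 => t _; rewrite lee_fin gamma_integrand_ge0. Qed.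

(* [egammaS] holds in [\bar R] before finiteness is known, so finiteness at [x]
   follows from finiteness at [x + 1], and [t ^ x <= 1 + t ^ m] reduces the
   latter to integer arguments. *)
Lemma egamma_lty x : 0 < x -> (egamma x < +oo)%E.
Proof.
move=> x0.
suff : (egamma (x + 1) < +oo)%E.
  rewrite egammaS// ltNge leye_eq => /negP nxy.
  rewrite ltNge leye_eq; apply/negP => /eqP xy; apply: nxy.
  by rewrite xy gt0_muley.
set m := (Num.truncn x).+1.
have xm : x <= m%:R by rewrite ltW// truncnS_gt.
apply: (@le_lt_trans _ _ (egamma 1 + egamma m.+1%:R)%E); last first.
  by rewrite lte_add_pinfty// ?egamma1_lty// egamma_nat_lty.
rewrite /egamma -ge0_integralD//; try by
  [move=> *; rewrite lee_fin gamma_integrand_ge0|exact: measurable_gamma_integrand].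
apply: ge0_le_integral => //.
- by move=> *; rewrite lee_fin gamma_integrand_ge0.
- exact: measurable_gamma_integrand.
- by apply: emeasurable_funD; exact: measurable_gamma_integrand.
- move=> t; rewrite /= in_itv/= andbT => t0.
  rewrite -EFinD lee_fin /gamma_integrand -mulrDl.
  rewrite ler_wpM2r ?expR_ge0// addrK subrr powRr0 -[m.+1%:R]natr1 addrK.
  have [t1|/ltW t1] := leP t 1.
    rewrite ler_wpDr ?powR_ge0//.
    by rewrite (le_trans (ger_powR _ (ltW x0))) ?powRr0// t0.
  by rewrite ler_wpDl// ler_powR.
Qed.

Lemma egamma_gt0 x : 0 < x -> (0 < egamma x)%E.
Proof.
(* [c] bounds the integrand below on [[1, 2]], where t ^ (x - 1) >= 1 / t >= 1 / 2 and exp (- t) >=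
   exp (- 2). *)
move=> x0; pose c := 2^-1 * expR (- 2) : R.
have c0 : 0 < c by rewrite mulr_gt0 ?expR_gt0// invr_gt0.
apply: (@lt_le_trans _ _ (\int[mu]_(t in `[1%R, 2%R]) (cst c%:E t))%E).
  rewrite integral_cst//= lebesgue_measure_itv/= lte_fin ltr1n.
  by rewrite -EFinB -EFinM lte_fin mulr_gt0// subr_gt0 ltr1n.
apply: (@le_trans _ _ (\int[mu]_(t in `[1%R, 2%R]) (gamma_integrand x t)%:E)%E).
  apply: ge0_le_integral => //.
  - by move=> t _; rewrite lee_fin ltW.
  - apply: measurable_funS (measurable_gamma_integrand x) => //.
    by move=> t /=; rewrite !in_itv/=; lra.
  - move=> t/=; rewrite in_itv/= => /andP[t1 t2].
    rewrite lee_fin ler_pM ?expR_ge0// ?ler_expR ?lerN2//.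
    rewrite (@le_trans _ _ (t `^ (-1)))//.
      by rewrite powRN powRr1 ?lef_pV2 ?posrE//; nra.
    by rewrite ler_powR//; lra.
apply: ge0_subset_integral => //.
- exact: measurable_gamma_integrand.
- by move=> t _; rewrite lee_fin gamma_integrand_ge0.
- move=> t/=; rewrite !in_itv/=; lra.
Qed.

Lemma Gamma_egamma x : 0 < x -> (Gamma x)%:E = egamma x.
Proof.
move=> x0; rewrite /Gamma/Rintegral fineK//.
by rewrite ge0_fin_numE ?egamma_lty ?egamma_ge0.
Qed.

Lemma Gamma_gt0 x : 0 < x -> 0 < Gamma x.
Proof. by move=> x0; rewrite -lte_fin Gamma_egamma// egamma_gt0. Qed.

Lemma GammaS x : 0 < x -> Gamma (x + 1) = x * Gamma x.
Proof.
move=> x0; apply: EFin_inj.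
by rewrite EFinM !Gamma_egamma ?egammaS ?addr_gt0.
Qed.

(** Turns the quotient of Gammas in [nb_pmf] into a finite product, whose logarithm can be
    differentiated in [nu] term by term. *)
Lemma GammaD x (n : nat) : 0 < x ->
  Gamma (x + n%:R) = Gamma x * \prod_(j < n) (x + j%:R).
Proof.
move=> x0; elim: n => [|n ih]; first by rewrite addr0 big_ord0 mulr1.
have xn : 0 < x + n%:R by rewrite ltr_wpDr.
by rewrite -natr1 addrA GammaS// ih big_ord_recr/=; ring.
Qed.

End gamma.

(** * Derivative rules for functions given pointwise *)

Section pointwise_derivatives.
Context {R : realType}.
Implicit Types (f g : R -> R) (x a b c : R).

Lemma is_derive1D f g x a b : is_derive x 1 f a -> is_derive x 1 g b ->
  is_derive x 1 (fun t => f t + g t) (a + b).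
Proof. by move=> df dg; exact: is_deriveD. Qed.

Lemma is_derive1B f g x a b : is_derive x 1 f a -> is_derive x 1 g b ->
  is_derive x 1 (fun t => f t - g t) (a - b).
Proof. by move=> df dg; exact: is_deriveB. Qed.

Lemma is_derive1M f g x a b : is_derive x 1 f a -> is_derive x 1 g b ->
  is_derive x 1 (fun t => f t * g t) (f x * b + g x * a).
Proof. by move=> df dg; exact: is_deriveM. Qed.

Lemma is_derive1Ml f x a c : is_derive x 1 f a ->
  is_derive x 1 (fun t => c * f t) (c * a).
Proof. by move=> df; exact: is_deriveZ. Qed.

Lemma is_derive1Mr f x a c : is_derive x 1 f a ->
  is_derive x 1 (fun t => f t * c) (a * c).
Proof.
by move=> /(@is_derive1Ml _ _ _ c); rewrite mulrC; under eq_fun do rewrite mulrC.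
Qed.

Lemma is_derive1X x n : is_derive x 1 (fun t => t ^+ n) (n%:R * x ^+ n.-1).
Proof.
have -> : (fun t => t ^+ n) = (id : R -> R) ^+ n by apply/funext => t; rewrite fctE.
by apply: is_derive_eq; rewrite scaler1.
Qed.

Lemma is_derive1_sum n (f : 'I_n -> R -> R) x (a : 'I_n -> R) :
  (forall i, is_derive x 1 (f i) (a i)) ->
  is_derive x 1 (fun t => \sum_(i < n) f i t) (\sum_(i < n) a i).
Proof. by move=> /is_derive_sum; rewrite fct_sumE. Qed.

Lemma is_derive1_lnD x c : 0 < c + x -> is_derive x 1 (fun t => ln (c + t)) (c + x)^-1.
Proof.
move=> cx.
have d : is_derive x 1 (fun t : R => c + t) 1.
  by rewrite -[X in is_derive _ _ _ X]add0r; apply: is_derive1D.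
have := @is_derive1_comp R (@ln R) (fun t => c + t) x _ _ (is_derive1_ln cx) d.
by rewrite mulr1.
Qed.

End pointwise_derivatives.

(** * Poisson weights and a truncated Jensen inequality *)

Section poisson_inequality.
Context {R : realType}.
Implicit Types (t nu : R).

(** No test on the sign of [t], so that it is differentiable at [t = 0], where the comparison in
    [poi_score_lb] starts. *)
Definition poi t k : R := t ^+ k / k`!%:R * expR (- t).
(** The bound is strict: this is P(Y < n), hence [1 - poi_cdf t k.+1] is P(Y > k). *)
Definition poi_cdf t n : R := \sum_(k < n) poi t k.

Lemma poi_ge0 t k : 0 <= t -> 0 <= poi t k.
Proof. by move=> t0; rewrite !mulr_ge0 ?expR_ge0 ?exprn_ge0 ?invr_ge0. Qed.

Lemma poiS t k : poi t k.+1 * k.+1%:R = t * poi t k.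
Proof.
rewrite /poi factS natrM exprS.
have k1 : k.+1%:R != 0 :> R by rewrite pnatr_eq0.
have k2 : k`!%:R != 0 :> R by rewrite pnatr_eq0 -lt0n fact_gt0.
move: k1 k2; move: (k.+1%:R : R) (k`!%:R : R) => a b a0 b0.
by field; rewrite a0 b0.
Qed.

Lemma is_derive_poi t k :
  is_derive t 1 (poi^~ k) ((if k is k'.+1 then poi t k' else 0) - poi t k).
Proof.
have d : is_derive t (1:R) (fun t : R => expR (- t)) (- expR (- t)).
  by apply: is_derive_eq; rewrite mulrN1.
have := is_derive1M _ _ _ _ _ (is_derive1Mr _ _ _ k`!%:R^-1 (is_derive1X t k)) d.
move=> h; apply: (is_derive_eq h) => {h}; rewrite /poi mulrN addrC; congr (_ - _).
case: k => [|k]; first by rewrite mulr0n !mul0r mulr0.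
rewrite mulrC factS natrM/=; congr (_ * _).
have k1 : k.+1%:R != 0 :> R by rewrite pnatr_eq0.
have k2 : k`!%:R != 0 :> R by rewrite pnatr_eq0 -lt0n fact_gt0.
move: k1 k2; move: (k.+1%:R : R) (k`!%:R : R) => a b a0 b0.
by field; rewrite a0 b0.
Qed.

Lemma poi_cdfS t n : poi_cdf t n.+1 = poi_cdf t n + poi t n.
Proof. by rewrite /poi_cdf big_ord_recr. Qed.

Lemma is_derive_poi_cdf t n : is_derive t 1 (poi_cdf^~ n.+1) (- poi t n).
Proof.
rewrite /poi_cdf; have := is_derive1_sum _ _ _ _
  (fun i : 'I_n.+1 => is_derive_poi t i).
move=> h; apply: (is_derive_eq h) => {h}; elim: n => [|n ih].
  by rewrite big_ord_recr big_ord0/= !add0r.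
by rewrite big_ord_recr/= ih; ring.
Qed.

(** The sum telescopes by [poiS]. The full centred first moment is 0; the right-hand side is what
    truncation leaves. *)
Lemma poi_cdf_mean t n :
  \sum_(k < n.+1) poi t k * (k%:R - t) = - (t * poi t n).
Proof.
elim: n => [|n ih]; first by rewrite big_ord_recr big_ord0/=; ring.
rewrite big_ord_recr/= ih mulrBr poiS; ring.
Qed.

Lemma poi_cdf_cvg t : poi_cdf t n @[n --> \oo] --> (1 : R).
Proof.
have -> : poi_cdf t = (fun n => series (exp_coeff t) n * expR (- t)).
  apply/funext => n; rewrite /poi_cdf /series/= big_mkord mulr_suml.
  by apply: eq_bigr => k _.
rewrite -[1](mulfV (lt0r_neq0 (expR_gt0 t))) -expRN.
apply: cvgM; last exact: cvg_cst.
exact: is_cvg_series_exp_coeff.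
Qed.

Lemma poi_cdf_le1 t n : 0 <= t -> poi_cdf t n <= 1.
Proof.
move=> t0; have nd : nondecreasing_seq (poi_cdf t).
  by apply/nondecreasing_seqP => m; rewrite poi_cdfS lerDl poi_ge0.
rewrite -(cvg_lim _ (poi_cdf_cvg t))//.
by apply: nondecreasing_cvgn_le => //; apply/cvg_ex; exists 1; exact: poi_cdf_cvg.
Qed.

(* Jensen for [1 / (nu + Y)], keeping the contribution of [Y = 0] to the
   remainder [(Y - t) ^ 2 / ((nu + t) ^ 2 (nu + Y))] *)
Lemma poi_jensen t nu n : 0 <= t -> 0 < nu ->
  nu / (nu + t) * poi_cdf t n.+1 + t ^+ 2 / (nu + t) ^+ 2 * expR (- t) <=
  \sum_(k < n.+1) poi t k * (nu / (nu + k%:R)).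
Proof.
move=> t0 nu0; have nt : 0 < nu + t by rewrite ltr_pwDl.
have : \sum_(k < n.+1) (poi t k * (nu / (nu + t))
    - nu / (nu + t) ^+ 2 * (poi t k * (k%:R - t))
    + t ^+ 2 / (nu + t) ^+ 2 * (poi t k * (k == 0%N :> nat)%:R)) <=
  \sum_(k < n.+1) poi t k * (nu / (nu + k%:R)).
  apply: ler_sum => -[k /= _] _.
  have nk : 0 < nu + k%:R by rewrite ltr_wpDr.
  rewrite -subr_ge0.
  have -> : poi t k * (nu / (nu + k%:R)) - (poi t k * (nu / (nu + t))
    - nu / (nu + t) ^+ 2 * (poi t k * (k%:R - t))
    + t ^+ 2 / (nu + t) ^+ 2 * (poi t k * (k == 0%N)%:R)) =
    poi t k / (nu + t) ^+ 2 * (nu / (nu + k%:R) * (k%:R - t) ^+ 2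
     - t ^+ 2 * (k == 0%N)%:R).
    by field; rewrite !gt_eqF.
  rewrite mulr_ge0 ?divr_ge0 ?poi_ge0 ?sqr_ge0//.
  (* At [k = 0] the square remainder equals the retained term; for [k > 0] it is dropped. *)
  case: k nk => [_|k nk]; first by
    rewrite mulr0n addr0 divff; [rewrite mul1r sub0r sqrrN mulr1 subrr|rewrite gt_eqF].
  by rewrite mulr0 subr0 mulr_ge0 ?sqr_ge0// divr_ge0 ?ltW.
rewrite !big_split/= sumrN -mulr_suml -!mulr_sumr poi_cdf_mean.
apply: le_trans.
have -> : \sum_(k < n.+1) poi t k * (k == 0%N :> nat)%:R = expR (- t).
  rewrite big_ord_recl/= big1 => [|i _]; last by rewrite mulr0.
  by rewrite /poi expr0 fact0 invr1 !mulr1 mul1r addr0.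
(* The linear term, evaluated by [poi_cdf_mean], makes a nonnegative contribution, which is
   discarded. *)
rewrite lerD2r -/(poi_cdf t n.+1) mulrC mulrN opprK lerDl.
by rewrite mulr_ge0 ?(mulr_ge0 t0) ?divr_ge0 ?poi_ge0 ?sqr_ge0 ?(ltW nu0).
Qed.

End poisson_inequality.

(** * Uniform positivity of the limiting score *)

Section poisson_score.
Context {R : realType}.
Implicit Types (t nu lam : R).

Lemma poi_cdf0 n : poi_cdf (0 : R) n.+1 = 1.
Proof.
rewrite /poi_cdf big_ord_recl/= big1 => [|i _].
  by rewrite /poi expr0 fact0 oppr0 expR0 invr1 !mulr1 addr0.
by rewrite /poi expr0n/= !mul0r.
Qed.

(* As a function of [t = lam], the right-hand side minus the left-hand side
   vanishes at [0]; its derivative is nonnegative by [poi_jensen], the summand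
   [lam * (1 - poi_cdf lam n.+1)] paying for the truncation of the sum. *)
Lemma poi_score_lb lam numax nu n : 0 < lam -> 0 < nu -> nu <= numax ->
  expR (- lam) / (numax + lam) ^+ 2 * (lam ^+ 3 / 3)
    - lam * (1 - poi_cdf lam n.+1) <=
  \sum_(k < n.+1) (1 - poi_cdf lam k.+1) * (nu / (nu + k%:R))
    - nu * (ln (nu + lam) - ln nu).
Proof.
move=> lam0 nu0 num.
(* [c] bounds from below, uniformly in [nu <= numax] and [u <= lam], the coefficient exp (- u) / (nu
   + u) ^ 2 of u ^ 2 in [poi_jensen]. *)
set c := _ / _.
pose G t := (\sum_(k < n.+1) (1 - poi_cdf t k.+1) * (nu / (nu + k%:R))
    - nu * (ln (nu + t) - ln nu)) - (c * (t ^+ 3 / 3) - t * (1 - poi_cdf t n.+1)).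
pose dG t := (\sum_(k < n.+1) poi t k * (nu / (nu + k%:R)) - nu * ((nu + t)^-1 - 0))
   - (c * t ^+ 2 - (t * poi t n + (1 - poi_cdf t n.+1))).
have dcdf t k : is_derive t 1 (fun t => 1 - poi_cdf t k.+1) (poi t k).
  have c1 : is_derive t (1:R) (fun=> 1 : R) 0 by exact: is_derive_cst.
  have := is_derive1B _ _ _ _ _ c1 (is_derive_poi_cdf t k).
  by move=> h; apply: (is_derive_eq h); rewrite sub0r opprK.
have der t : 0 <= t -> is_derive t 1 G (dG t).
  move=> t0; have nt : 0 < nu + t by rewrite ltr_pwDl.
  apply: is_derive1B; first apply: is_derive1B.
  - by apply: is_derive1_sum => i; apply: is_derive1Mr.
  - by apply: is_derive1Ml; apply: is_derive1B; exact: is_derive1_lnD.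
  - apply: is_derive1B.
    + apply: is_derive1Ml.
      apply: (is_derive_eq (is_derive1Mr _ _ _ _ (is_derive1X t 3))).
      by rewrite mulrAC divff ?mul1r// pnatr_eq0.
    + have h := is_derive1M _ _ _ _ _ (is_derive_id t 1) (dcdf t n).
      by apply: (is_derive_eq h); rewrite mulr1.
rewrite -subr_ge0 -/(G lam).
have G0 : G 0 = 0.
  rewrite /G big1 => [|i _]; last by rewrite poi_cdf0 subrr mul0r.
  by rewrite addr0 poi_cdf0 !subrr expr0n/= !(mul0r,mulr0) !subr0.
have [||u /itvP ul] := @MVT R G dG 0 lam lam0.
- by move=> t; rewrite in_itv/= => /andP[/ltW + _]; exact: der.
- apply: derivable_within_continuous => t; rewrite in_itv/= => /andP[+ _].
  by move=> /der h; apply: ex_derive.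
have u0 : 0 < u by rewrite ul.
have ulam : u < lam by rewrite ul.
rewrite G0 subr0 => ->; rewrite subr0 mulr_ge0 ?(ltW lam0)//.
have J := poi_jensen u nu n (ltW u0) nu0.
have nut : 0 < nu + u by rewrite addr_gt0.
have cu : c * u ^+ 2 <= u ^+ 2 / (nu + u) ^+ 2 * expR (- u).
  rewrite [leRHS](_ : _ = expR (- u) / (nu + u) ^+ 2 * u ^+ 2); last by ring.
  rewrite ler_wpM2r ?sqr_ge0//.
  rewrite ler_pM ?expR_ge0 ?invr_ge0 ?sqr_ge0 ?ler_expR ?lerN2 ?(ltW ulam)//.
  have nl : 0 < numax + lam by lra.
  rewrite lef_pV2 ?posrE ?exprn_gt0//.
  by rewrite ler_pXn2r ?nnegrE ?(ltW nl) ?(ltW nut)//; lra.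
(* [poi_jensen] has [poi_cdf u n.+1] in place of 1; the term [1 - poi_cdf u n.+1] of [dG] covers the
   shortfall. *)
have tail : nu / (nu + u) * (1 - poi_cdf u n.+1) <= 1 - poi_cdf u n.+1.
  rewrite ler_piMl ?subr_ge0 ?poi_cdf_le1 ?(ltW u0)//.
  by rewrite ler_pdivrMr// mul1r lerDl ltW.
have pos : 0 <= u * poi u n by rewrite mulr_ge0 ?poi_ge0// ltW.
rewrite /dG subr0; lra.
Qed.

(** The gain [d] in [poi_score_lb] depends neither on [nu] nor on the truncation, whose cost tends
    to 0: the sum is cut where it costs at most half of [d]. *)
Lemma poi_score_gt0 lam numax : 0 < lam -> 0 < numax ->
  exists n, exists2 delta : R, 0 < delta & forall nu, 0 < nu -> nu <= numax ->
  delta <=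
  \sum_(k < n) (1 - poi_cdf lam k.+1) * (nu / (nu + k%:R))
    - nu * (ln (nu + lam) - ln nu).
Proof.
move=> lam0 num0.
set d := expR (- lam) / (numax + lam) ^+ 2 * (lam ^+ 3 / 3).
have d0 : 0 < d.
  by rewrite !mulr_gt0 ?expR_gt0 ?invr_gt0 ?exprn_gt0 ?addr_gt0 ?ltr0n.
have : \forall n \near \oo, 1 - d / 2 / lam < poi_cdf lam n.
  have := poi_cdf_cvg lam => /cvgrPdist_lt /(_ (d / 2 / lam)).
  move=> /(_ _)/[!divr_gt0]// /(_ isT).
  by apply: filterS => n; rewrite ltr_norml => /andP[_]; lra.
case=> n _ /(_ n.+1 (leqnSn n)) hn.
exists n.+1, (d / 2); first by rewrite divr_gt0.
move=> nu nu0 num; apply: le_trans (poi_score_lb _ _ _ n lam0 nu0 num).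
rewrite -/d.
have : lam * (1 - poi_cdf lam n.+1) <= d / 2.
  by rewrite -ler_pdivlMl// mulrC ltW//; lra.
lra.
Qed.

End poisson_score.

(** * The negative binomial likelihood and its profile in [nu] *)

Section negative_binomial_likelihood.
Context {R : realType}.
Implicit Types (p nu x a b : R).

Lemma ln_lt_subr1 x : 0 < x -> x != 1 -> ln x < x - 1.
Proof.
move=> x0 x1; rewrite ltrBrDl -[ltRHS](lnK x0).
by apply: expR_gt1Dx; rewrite ln_eq0.
Qed.

Lemma ln_le_subr1 x : 0 < x -> ln x <= x - 1.
Proof.
move=> x0; have [->|x1] := eqVneq x 1; first by rewrite ln1 subrr.
exact/ltW/ln_lt_subr1.
Qed.

(** Gibbs' inequality: ln x <= x - 1 is applied to p / q and (1 - p) / r, and the linear bounds add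
    up to 0. The first instance is strict, which makes the best [p] unique. *)
Lemma bernoulli_loglik_lt a b p : 0 < a -> 0 < b -> 0 < p < 1 ->
  p != a / (a + b) ->
  a * ln p + b * ln (1 - p) < a * ln (a / (a + b)) + b * ln (b / (a + b)).
Proof.
move=> a0 b0 /andP[p0 p1] pq; have ab : 0 < a + b by rewrite addr_gt0.
set q := a / (a + b); set r := b / (a + b).
have q0 : 0 < q by rewrite divr_gt0.
have r0 : 0 < r by rewrite divr_gt0.
have p1' : 0 < 1 - p by rewrite subr_gt0.
have h1 : a * (ln p - ln q) < a * (p / q - 1).
  rewrite ltr_pM2l// -ln_div ?posrE//; apply: ln_lt_subr1.
    by rewrite divr_gt0.
  apply: contra pq => /eqP pq; apply/eqP.
  by rewrite -[LHS](@divfK _ q) ?gt_eqF// pq mul1r.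
have h2 : b * (ln (1 - p) - ln r) <= b * ((1 - p) / r - 1).
  by rewrite ler_pM2l// -ln_div ?posrE//; apply: ln_le_subr1; rewrite divr_gt0.
have h3 : a * (p / q - 1) + b * ((1 - p) / r - 1) = 0.
  by rewrite /q /r; field; rewrite !gt_eqF.
lra.
Qed.

(** For [nu > 0], the logarithm of Gamma (nu + k) / Gamma nu, by [GammaD]. *)
Definition rising_loglik nu (k : nat) : R := \sum_(j < k) ln (nu + j%:R).

Lemma nb_pmfE nu p k : 0 < nu -> 0 < p < 1 ->
  nb_pmf nu p k = (Gamma (k%:R + 1))^-1 *
    expR (rising_loglik nu k + nu * ln p + k%:R * ln (1 - p)).
Proof.
move=> nu0 /andP[p0 p1]; rewrite /nb_pmf lt_eqF// GammaD//.
have g : Gamma nu != 0 by rewrite gt_eqF// Gamma_gt0.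
have gk : Gamma (k%:R + 1) != 0 :> R by rewrite gt_eqF// Gamma_gt0// ltr_wpDl.
rewrite !expRD expR_sum expRM_natl lnK ?posrE ?subr_gt0//.
rewrite (_ : \prod_(j < k) expR _ = \prod_(j < k) (nu + j%:R)); last first.
  by apply: eq_bigr => j _; rewrite lnK// posrE ltr_wpDr.
rewrite /powR gt_eqF//.
move: (Gamma nu) (Gamma _) g gk => u v u0 v0.
by field; rewrite u0 v0.
Qed.

Variables (n : nat) (y : 'I_n -> nat).

(* The log-likelihood per observation, up to an additive constant. *)
Definition nb_loglik nu p : R :=
  n%:R^-1 * (\sum_(i < n) rising_loglik nu (y i)) + nu * ln p
  + sample_mean y * ln (1 - p).

Lemma nb_likelihoodE nu p : 0 < nu -> 0 < p < 1 -> (0 < n)%N ->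
  nb_likelihood y (nu, p) = \prod_(i < n) (Gamma ((y i)%:R + 1))^-1 *
    expR (n%:R * nb_loglik nu p).
Proof.
move=> nu0 p01 n0; rewrite /nb_likelihood/=.
under eq_bigr do rewrite nb_pmfE//.
rewrite big_split/= -expR_sum; congr (_ * expR _).
rewrite !big_split/= sumr_const card_ord -mulr_suml /nb_loglik /sample_mean.
have n1 : n%:R != 0 :> R by rewrite pnatr_eq0 -lt0n.
rewrite -[(nu * ln p) *+ n]mulr_natl.
by rewrite !mulrDr !mulrA !divff// !mul1r.
Qed.

Hypothesis mean0 : 0 < sample_mean y :> R.
Local Notation m := (sample_mean y : R).

Lemma sample_mean_gt0_pos : (0 < n)%N.
Proof.
rewrite lt0n; apply: contraTneq mean0 => n0.
(* The inverse of 0 is 0, so an empty sample would have mean 0. *)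
have nV0 : n%:R^-1 = 0 :> R by rewrite n0 invr0.
by rewrite /sample_mean nV0 mul0r ltxx.
Qed.

(** A positive mean forces a positive observation, which the point mass at 0 excludes; so [p = 1]
    never competes. *)
Lemma nb_likelihood1 nu : nb_likelihood y (nu, 1) = 0 :> R.
Proof.
have : exists i, (0 < y i)%N.
  apply: contrapT => /forallNP h; move: mean0; rewrite /sample_mean big1.
    by rewrite mulr0 ltxx.
  by move=> i _; case: (y i) (h i).
case=> i yi; rewrite /nb_likelihood (bigD1 i)//= /nb_pmf eqxx.
by case: (y i) yi => // k _; rewrite mul0r.
Qed.

Variable numax : R.
Hypothesis numax0 : 0 < numax.
(** Positivity of [nu] times the derivative of [nb_profile]; [empirical_score_gt0] will supply
    it. *)
Hypothesis score : forall nu, 0 < nu -> nu <= numax ->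
  nu * (ln (nu + m) - ln nu) <
  n%:R^-1 * \sum_(i < n) \sum_(j < y i) (nu / (nu + j%:R)).

(* [nb_loglik] maximized over [p]: see [nb_loglik_max] and [nb_loglik_lt] *)
Definition nb_profile nu : R :=
  n%:R^-1 * (\sum_(i < n) rising_loglik nu (y i)) + nu * (ln nu - ln (nu + m))
  + m * (ln m - ln (nu + m)).

Lemma is_derive_nb_profile nu : 0 < nu ->
  is_derive nu 1 nb_profile
  (n%:R^-1 * (\sum_(i < n) \sum_(j < y i) (nu + j%:R)^-1)
    - (ln (nu + m) - ln nu)).
Proof.
move=> nu0; have num : 0 < nu + m by rewrite addr_gt0.
have dlnD c : 0 < nu + c -> is_derive nu 1 (fun x => ln (x + c)) (nu + c)^-1.
  move=> nuc; have /is_derive1_lnD : 0 < c + nu by rewrite addrC.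
  by under eq_fun do rewrite addrC; rewrite addrC.
have dlnm := dlnD _ num.
have h1 : is_derive nu 1 (fun x => n%:R^-1 * (\sum_(i < n) rising_loglik x (y i)))
    (n%:R^-1 * (\sum_(i < n) \sum_(j < y i) (nu + j%:R)^-1)).
  apply: is_derive1Ml; apply: is_derive1_sum => i; apply: is_derive1_sum => j.
  by apply: dlnD; rewrite ltr_wpDr.
have h2 := is_derive1M _ _ _ _ _ (is_derive_id nu (1 : R))
  (is_derive1B _ _ _ _ _ (is_derive1_ln nu0) dlnm).
have cm : is_derive nu (1 : R) (fun=> ln m) 0 by exact: is_derive_cst.
have h3 := is_derive1Ml _ _ _ m (is_derive1B _ _ _ _ _ cm dlnm).
apply: (is_derive_eq (is_derive1D _ _ _ _ _ (is_derive1D _ _ _ _ _ h1 h2) h3)).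
by move: (n%:R^-1 * _) => s; field; rewrite !gt_eqF.
Qed.

Lemma nb_profile_lt nu : 0 < nu -> nu < numax -> nb_profile nu < nb_profile numax.
Proof.
move=> nu0 num.
have d t : t \in `]nu, numax[ -> is_derive t 1 nb_profile
    (n%:R^-1 * (\sum_(i < n) \sum_(j < y i) (t + j%:R)^-1)
      - (ln (t + m) - ln t)).
  by rewrite in_itv/= => /andP[/(lt_trans nu0) t0 _]; exact: is_derive_nb_profile.
have [|u /itvP uu h] := MVT num d.
  apply: derivable_within_continuous => t.
  rewrite in_itv/= => /andP[/(lt_le_trans nu0)].
  by move=> /is_derive_nb_profile dt _; apply: ex_derive.
have u0 : 0 < u by rewrite (lt_trans nu0)// uu.
rewrite -subr_gt0 h mulr_gt0 ?subr_gt0//.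
(* Multiplied by [u], positivity of the derivative becomes [score]. *)
rewrite -(ltr_pM2l u0); have := score u u0; rewrite uu => /(_ isT).
move=> /lt_le_trans; apply.
rewrite [leRHS]mulrCA [in leRHS]mulr_sumr; under [in leRHS]eq_bigr do rewrite mulr_sumr.
by [].
Qed.

Lemma nb_loglik_max nu : 0 < nu -> nb_loglik nu (nu / (nu + m)) = nb_profile nu.
Proof.
move=> nu0; have num : 0 < nu + m by rewrite addr_gt0.
rewrite /nb_loglik (_ : 1 - nu / (nu + m) = m / (nu + m)); last first.
  by field; rewrite gt_eqF.
by rewrite !ln_div ?posrE.
Qed.

Lemma nb_loglik_lt nu p : 0 < nu -> 0 < p < 1 -> p != nu / (nu + m) ->
  nb_loglik nu p < nb_profile nu.
Proof.
move=> nu0 p01 pq; have num : 0 < nu + m by rewrite addr_gt0.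
have := bernoulli_loglik_lt _ _ _ nu0 mean0 p01 pq.
by rewrite /nb_profile /nb_loglik !ln_div ?posrE//; lra.
Qed.

(** Every other admissible point is strictly worse: [p = 1] has likelihood 0, a wrong [p] loses to
    the profile, and the profile increases up to [numax]. Strictness yields uniqueness as well. *)
Lemma nb_mle_numax : nb_mle numax y = [set (numax, numax / (numax + m))].
Proof.
have numaxm : 0 < numax + m by rewrite addr_gt0.
have q01 : 0 < numax / (numax + m) < 1.
  by rewrite divr_gt0//= ltr_pdivrMr// mul1r ltrDl.
have param : nb_param numax (numax, numax / (numax + m)).
  by split; rewrite /= in_itv/= ?lexx ?numax0//; case/andP: q01 => -> /ltW ->.
have n0 := sample_mean_gt0_pos.
have C0 : 0 < \prod_(i < n) (Gamma ((y i)%:R + 1))^-1 :> R.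
  by apply: prodr_gt0 => i _; rewrite invr_gt0 Gamma_gt0// ltr_wpDl.
have lt_max theta : nb_param numax theta ->
    theta <> (numax, numax / (numax + m)) ->
    nb_likelihood y theta < nb_likelihood y (numax, numax / (numax + m)).
  case: theta => nu p [/=]; rewrite !in_itv/=.
  move=> /andP[nu0 num] /andP[p0]; rewrite le_eqVlt => /predU1P[->|p1] neq.
    by rewrite nb_likelihood1 nb_likelihoodE// mulr_gt0 ?expR_gt0.
  have p01 : 0 < p < 1 by rewrite p0.
  rewrite !nb_likelihoodE// ltr_pM2l// ltr_expR ltr_pM2l ?ltr0n// nb_loglik_max//.
  have [pq|pq] := eqVneq p (nu / (nu + m)).
    rewrite pq nb_loglik_max// nb_profile_lt// lt_neqAle num andbT.
    by apply/eqP => nuE; apply: neq; rewrite pq nuE.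
  rewrite (lt_le_trans (nb_loglik_lt _ _ _ _ pq))//.
  move: num; rewrite le_eqVlt => /predU1P[->//|num].
  exact/ltW/nb_profile_lt.
apply/seteqP; split => [theta [htheta hmax]|_ ->].
  apply: contrapT => neq; have := lt_max _ htheta neq.
  by rewrite ltNge hmax.
split=> // theta htheta.
have [->//|/eqP neq] := eqVneq theta (numax, numax / (numax + m)).
exact/ltW/lt_max.
Qed.

End negative_binomial_likelihood.

(** * Product moments of independent variables and Borel-Cantelli *)

Section almost_sure_domination.
Context {R : realType} d (T : measurableType d) (P : probability T R).
Variables (Y : nat -> {RV P >-> nat}) (f : nat -> R).
Hypothesis indepY : mutually_independent Y.
Hypothesis pmfY : forall i, has_pmf (Y i) f.
Variables (u : nat -> R) (c : R).
Hypothesis u_ge0 : forall k, 0 <= u k.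
Hypothesis c_ge0 : 0 <= c.
Hypothesis sum_uf : \sum_(k < n) u k * f k @[n --> \oo] --> c.

Let M n w := \prod_(i < n) u (Y i w).

Let measurable_Y i (A : set nat) : measurable (Y i @^-1` A).
Proof. by rewrite -[_ @^-1` _]setTI; exact: measurable_funP. Qed.

Let M_ge0 n w : 0 <= M n w.
Proof. exact: prodr_ge0. Qed.

Let measurable_M n (D : set T) : measurable_fun D (M n).
Proof.
rewrite /M; apply: measurable_prod => i _.
apply: measurable_funTS => _ B mB; rewrite setTI.
exact: (measurable_Y i (u @^-1` B)).
Qed.

(** The event on later indices makes the induction work: splitting on the value of [Y n] moves the
    index [n] from the product into [J], so independence is only ever applied to events. An empty
    [J] gives the expectation [c ^+ n]. *)
Lemma integral_prod_indep n (J : {fset nat}) (A : nat -> set nat) :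
  (forall i, i \in J -> (n <= i)%N) ->
  (\int[P]_(w in \bigcap_(i in [set` J]) (Y i @^-1` A i)) (M n w)%:E =
   (c ^+ n)%:E * \prod_(i <- J) P (Y i @^-1` A i))%E.
Proof.
elim: n J A => [|n ih] J A hJ.
  rewrite -indepY// expr0 mul1e.
  under eq_integral do rewrite /M big_ord0.
  rewrite integral_cst ?mul1e//.
  by apply: fin_bigcap_measurable.
set E := \bigcap_(i in _) _.
have mE : measurable E by apply: fin_bigcap_measurable.
(* All indices in [J] exceed [n] here, so putting [[set k]] at [n] overwrites no constraint. *)
pose B k i := if i == n then [set k] else A i.
have nJ : n \notin J by apply/negP => /hJ; rewrite ltnn.
have EB k : E `&` (Y n @^-1` [set k]) =
    \bigcap_(i in [set` (n |` J)%fset]) (Y i @^-1` B k i).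
  rewrite set_fsetU1 bigcap_setU1 /B eqxx setIC; congr (_ `&` _).
  apply: eq_bigcapr => i /= iJ; case: eqVneq => // iE.
  by move: nJ; rewrite -iE iJ.
have EU : E = \bigcup_k (E `&` (Y n @^-1` [set k])).
  by rewrite -setI_bigcupr -preimage_bigcup; apply/seteqP; split => w//=;
    [move=> Ew; split => //; exists (Y n w)|case].
have mEk k : measurable (E `&` (Y n @^-1` [set k])).
  exact: measurableI _ _ mE (measurable_Y n [set k]).
rewrite [in LHS]EU ge0_integral_bigcup//; last first.
- by move=> i j _ _ [w [[_ /= <-] [_ /= ->]]].
- by move=> w _; rewrite lee_fin.
- by apply/measurable_EFinP.
have fin_prod : (\prod_(i <- J) P (Y i @^-1` A i))%E \is a fin_num.
  by rewrite -indepY// fin_num_measure.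
transitivity (\sum_(k <oo) ((c ^+ n)%:E * \prod_(i <- J) P (Y i @^-1` A i)) *
    (u k * f k)%:E)%E.
  apply: eq_eseriesr => k _.
  transitivity (\int[P]_(w in E `&` Y n @^-1` [set k]) ((u k)%:E * (M n w)%:E))%E.
    apply: eq_integral => w; rewrite inE => -[_ /= Yk].
    by rewrite -EFinM /M big_ord_recr/= Yk mulrC.
  rewrite ge0_integralZl ?lee_fin//; last 2 first.
  - exact/measurable_EFinP.
  - by move=> w _; rewrite lee_fin.
  rewrite EB ih; last first.
    by move=> i; rewrite !inE => /predU1P[->//|/hJ/ltnW].
  rewrite big_fsetU1//= {1}/B eqxx (pmfY n k : P (Y n @^-1` [set k]) = _).
  rewrite (_ : \prod_(i <- J) _ = \prod_(i <- J) P (Y i @^-1` A i))%E; last first.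
    rewrite big_seq [RHS]big_seq; apply: eq_bigr => i iJ.
    by rewrite /B; case: eqVneq => // iE; move: nJ; rewrite -iE iJ.
  by rewrite -(fineK fin_prod) -!EFinM; congr EFin; ring.
rewrite -(fineK fin_prod) -EFinM nneseriesZl//; last first.
  move=> k _; rewrite lee_fin mulr_ge0// -lee_fin -(pmfY 0%N).
  exact: measure_ge0.
rewrite (_ : (\sum_(k <oo) (u k * f k)%:E)%E = c%:E).
  by rewrite -!EFinM exprSr mulrAC.
apply/cvg_lim => //; apply: cvg_EFin.
  by apply: nearW => m; rewrite sumEFin.
apply: cvg_trans sum_uf; apply: near_eq_cvg; apply: nearW => m.
by rewrite /= sumEFin/= big_mkord.
Qed.

(* Markov's inequality bounds the probability of failure by [c ^+ n], which is
   summable, so Borel-Cantelli applies. *)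
Lemma ae_prod_indep_lt1 : c < 1 ->
  {ae P, forall w, \forall n \near \oo, \prod_(i < n) u (Y i w) < 1}.
Proof.
move=> c1; pose F n := [set w | 1 <= M n w].
have mF n : measurable (F n).
  rewrite -[F n]setTI; apply: measurable_fun_le => //.
have PF n : (P (F n) <= (c ^+ n)%:E)%E.
  (* With [J] empty the domain of integration is the whole space. *)
  have := integral_prod_indep n fset0 (fun=> setT).
  rewrite big_seq_fset0 mule1 => <-//.
  rewrite (_ : \bigcap_(i in _) _ = setT); last by apply/seteqP; split.
  apply: (@le_trans _ _ (\int[P]_(w in F n) (M n w)%:E)%E).
    rewrite -[leLHS]mul1e -integral_cst//; apply: ge0_le_integral => //.
    exact/measurable_EFinP.
  apply: ge0_subset_integral => //.
    exact/measurable_EFinP.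
  by move=> w _; rewrite lee_fin.
have : P (lim_sup_set F) = 0%E.
  apply: lim_sup_set_cvg0 => //.
  apply: (@le_lt_trans _ _ (\sum_(n <oo) (c ^+ n)%:E)%E).
    by apply: lee_nneseries => // n _; exact: PF.
  have -> : (\sum_(n <oo) (c ^+ n)%:E = ((1 - c)^-1)%:E)%E.
    apply/cvg_lim => //.
    have := @cvg_geometric_series R 1 c; rewrite ger0_norm// mul1r => /(_ c1) h.
    apply: cvg_EFin; first by apply: nearW => n; rewrite sumEFin.
    apply: cvg_trans h; apply: near_eq_cvg; apply: nearW => n.
    rewrite /= sumEFin/=; apply: eq_bigr => k _.
    by rewrite /geometric/= mul1r.
  exact: ltry.
move=> PF0; exists (lim_sup_set F); split => //.
  apply: bigcap_measurable => // k _; exact: bigcup_measurable.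
move=> w /= hw n _; apply: contrapT => hn; apply: hw.
exists n => // m /= nm; rewrite ltNge; apply/negP => Fm; apply: hn.
by exists m.
Qed.

End almost_sure_domination.

(** * Chernoff bounds for Poisson samples *)

Section poisson_law_of_large_numbers.
Context {R : realType} d (T : measurableType d) (P : probability T R).
Variable lambda : R.
Hypothesis lambda0 : 0 < lambda.
Variable Y : nat -> {RV P >-> nat}.
Hypothesis indepY : mutually_independent Y.
Hypothesis poissonY : forall i, has_pmf (Y i) (poisson_pmf lambda).

Lemma poisson_pmfE k : poisson_pmf lambda k = poi lambda k.
Proof. by rewrite /poisson_pmf lambda0. Qed.

Lemma chernoff_exponent (q eps : R) : 0 <= q -> 0 < eps ->
  exists2 s : R, 0 < s & q * (expR s - 1) < s * (q + eps).
Proof.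
move=> q0 e0; have qe : 0 < q + eps by rewrite ltr_wpDl.
(* As exp s <= 1 / (1 - s), it is enough that s (q + eps) < eps; this choice makes it eps / 2. *)
pose s := eps / (2 * (q + eps)).
have s0 : 0 < s by rewrite divr_gt0// mulr_gt0.
have sE : s * (2 * (q + eps)) = eps by rewrite divfK// gt_eqF// mulr_gt0.
have s1 : s < 1 by nra.
exists s => //.
have es : expR s * (1 - s) <= 1.
  have := expR_ge1Dx (- s); rewrite expRN => h.
  by rewrite mulrC -ler_pdivlMr ?expR_gt0// mul1r.
have : (q * (expR s - 1)) * (1 - s) < (s * (q + eps)) * (1 - s) by nra.
by rewrite ltr_pM2r// subr_gt0.
Qed.

(** Chernoff's method: exponential weights turn a bound on the mean into a product below 1. The
    assumed bound is the moment generating function of Poisson(q), which serves both the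
    observations and their indicators. *)
Lemma ae_sum_lt (phi : nat -> R) (q eps : R) : 0 <= q -> 0 < eps ->
  (forall s, 0 < s -> exists2 c, c <= expR (q * (expR s - 1)) &
    \sum_(k < n) expR (s * phi k) * poi lambda k @[n --> \oo] --> c) ->
  {ae P, forall w, \forall n \near \oo,
    n%:R^-1 * \sum_(i < n) phi (Y i w) < q + eps}.
Proof.
move=> q0 e0 mgf; have [s s0 sq] := chernoff_exponent _ _ q0 e0.
have [c cle cvgc] := mgf s s0.
pose u k := expR (s * (phi k - (q + eps))).
have uE k : u k = expR (- (s * (q + eps))) * expR (s * phi k).
  by rewrite -expRD /u; congr expR; ring.
have c0 : 0 <= c.
  rewrite -(cvg_lim _ cvgc)//; apply: limr_ge; first by apply/cvg_ex; exists c.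
  apply: nearW => n; apply: sumr_ge0 => k _.
  by rewrite mulr_ge0 ?expR_ge0 ?poi_ge0// ltW.
have := @ae_prod_indep_lt1 _ _ _ P Y _ indepY poissonY u
  (expR (- (s * (q + eps))) * c).
case=> [k||||N [mN PN hN]].
- exact: expR_ge0.
- by rewrite mulr_ge0 ?expR_ge0.
- have h : expR (- (s * (q + eps))) * (\sum_(k < n) expR (s * phi k) * poi lambda k)
      @[n --> \oo] --> expR (- (s * (q + eps))) * c by exact: cvgMl_tmp.
  apply: cvg_trans h; apply: near_eq_cvg; apply: nearW => n.
  rewrite mulr_sumr; apply: eq_bigr => k _.
  by rewrite uE poisson_pmfE mulrA.
- rewrite mulrC -ltr_pdivlMr ?expR_gt0// mul1r -expRN opprK.
  by rewrite (le_lt_trans cle)// ltr_expR.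
exists N; split => // w /= hw; apply: hN => /= h; apply: hw.
apply: filterS h => n.
(* For [n = 0] the empty product is 1, contradicting the bound. *)
have [->|n0] := posnP n; first by rewrite big_ord0 ltxx.
rewrite -expR_sum expR_lt1 -mulr_sumr pmulr_rlt0// sumrB sumr_const card_ord.
by rewrite subr_lt0 -(mulr_natl (q + eps)) ltr_pdivrMl ?ltr0n.
Qed.

(** The moment generating function of Poisson(lambda) is resummed as the exponential series at
    [lambda * expR s], so the bound holds with equality. *)
Lemma ae_sample_mean_lt (eps : R) : 0 < eps ->
  {ae P, forall w, \forall n \near \oo,
    sample_mean (fun i : 'I_n => Y i w) < lambda + eps}.
Proof.
move=> e0; apply: (ae_sum_lt (fun k => k%:R)) => //; first exact: ltW.
move=> s s0; exists (expR (lambda * (expR s - 1))) => //.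
rewrite (_ : expR _ = expR (lambda * expR s) * expR (- lambda)); last first.
  by rewrite -expRD mulrBr mulr1.
have h : series (exp_coeff (lambda * expR s)) @ \oo --> expR (lambda * expR s).
  exact: is_cvg_series_exp_coeff.
have h' : series (exp_coeff (lambda * expR s)) n * expR (- lambda) @[n --> \oo] -->
    expR (lambda * expR s) * expR (- lambda) by exact: cvgMr_tmp.
apply: cvg_trans h'.
apply: near_eq_cvg; apply: nearW => n /=.
rewrite /series/= big_mkord mulr_suml; apply: eq_bigr => k _.
by rewrite /poi /exp_coeff/= exprMn -expRM_natr; ring.
Qed.

(** An indicator of mean q has moment generating function 1 + q (exp s - 1), below exp (q (exp s -
    1)). *)
Lemma ae_cdf_lt (eps : R) j : 0 < eps ->
  {ae P, forall w, \forall n \near \oo,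
    n%:R^-1 * \sum_(i < n) (Y i w < j)%N%:R < poi_cdf lambda j + eps}.
Proof.
move=> e0; have q0 : 0 <= poi_cdf lambda j.
  by apply: sumr_ge0 => k _; rewrite poi_ge0// ltW.
apply: (ae_sum_lt (fun k => (k < j)%N%:R)) => // s s0.
exists (1 + poi_cdf lambda j * (expR s - 1)); first exact: expR_ge1Dx.
set x := poi_cdf lambda j * _.
have h : poi_cdf lambda n + x @[n --> \oo] --> 1 + x.
  by apply: cvgD; [exact: poi_cdf_cvg|exact: cvg_cst].
apply: cvg_trans h; apply: near_eq_cvg; exists j => // n /= jn.
rewrite /x /poi_cdf (big_ord_widen _ (fun k => poi lambda k) jn) /=.
rewrite mulr_suml [in X in _ + X]big_mkcond -big_split/=; apply: eq_bigr => k _.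
by case: ifP => _; rewrite ?mulr1 ?mulr0 ?expR0; ring.
Qed.

End poisson_law_of_large_numbers.

(** * From the limiting score to the empirical one *)

Section empirical_score.
Context {R : realType}.
Variables (n : nat) (y : 'I_n -> nat).

Lemma sum_trunc_le (g : nat -> R) (k l : nat) : (forall j, 0 <= g j) ->
  \sum_(j < k) (j < l)%N%:R * g j <= \sum_(j < l) g j.
Proof.
move=> g0; rewrite (big_ord_widen _ (fun j => (j < l)%N%:R * g j) (leq_addr l k)).
rewrite (big_ord_widen _ g (leq_addl k l)) big_mkcond [leRHS]big_mkcond/=.
by apply: ler_sum => j _; do 2 case: ifP => _; rewrite ?mul1r ?mul0r.
Qed.

(** Each of the [K] empirical tails costs at most [eps], the weights [g] being at most 1, and the
    logarithm costs one more [eps]. Only upward deviations of the mean and of the distribution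
    function hurt, so one-sided bounds suffice. *)
Lemma empirical_score_gt0 (lambda delta eps nu : R) (K : nat) :
  0 < lambda -> 0 < nu -> 0 < eps -> K.+1%:R * eps < delta ->
  delta <= \sum_(k < K) (1 - poi_cdf lambda k.+1) * (nu / (nu + k%:R))
    - nu * (ln (nu + lambda) - ln nu) ->
  (0 < n)%N ->
  sample_mean y < lambda + eps ->
  (forall k : 'I_K, n%:R^-1 * \sum_(i < n) (y i < k.+1)%N%:R <
     poi_cdf lambda k.+1 + eps) ->
  nu * (ln (nu + sample_mean y) - ln nu) <
  n%:R^-1 * \sum_(i < n) \sum_(j < y i) (nu / (nu + j%:R)).
Proof.
move=> lam0 nu0 eps0 Keps hdelta n0 hmean hcdf.
have n1 : n%:R != 0 :> R by rewrite pnatr_eq0 -lt0n.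
have m0 : 0 <= sample_mean y :> R.
  by rewrite mulr_ge0 ?invr_ge0// sumr_ge0.
have num : 0 < nu + sample_mean y by rewrite ltr_pwDl.
have nulam : 0 < nu + lambda by rewrite addr_gt0.
pose g (j : nat) := nu / (nu + j%:R).
have g0 j : 0 <= g j by rewrite divr_ge0// ?ltr_wpDr// ?addr_ge0// ltW.
have g1 j : g j <= 1.
  by rewrite ler_pdivrMr ?ltr_wpDr// mul1r lerDl.
have hln : nu * (ln (nu + sample_mean y) - ln (nu + lambda)) <= eps.
  rewrite -ln_div ?posrE//.
  apply: (@le_trans _ _ (nu * ((nu + sample_mean y) / (nu + lambda) - 1))).
    by rewrite ler_pM2l// ln_le_subr1// divr_gt0.
  rewrite (_ : _ - 1 = (sample_mean y - lambda) / (nu + lambda)); last first.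
    by field; rewrite gt_eqF.
  rewrite mulrA ler_pdivrMr//; nra.
have hsum : \sum_(k < K) (1 - poi_cdf lambda k.+1) * g k - K%:R * eps <=
    n%:R^-1 * \sum_(i < n) \sum_(j < y i) g j.
  (* Drop the terms with [j >= K], then exchange the sums so that the empirical frequencies of
     [k < y i] appear. *)
  apply: (@le_trans _ _ (n%:R^-1 * \sum_(i < n) \sum_(k < K) (k < y i)%N%:R * g k)).
    rewrite exchange_big/= mulr_sumr.
    have -> : K%:R * eps = \sum_(k < K) eps by rewrite sumr_const card_ord mulr_natl.
    rewrite -sumrB; apply: ler_sum => k _; rewrite -mulr_suml [leRHS]mulrA.
    have -> : n%:R^-1 * \sum_(i < n) (k < y i)%N%:R =
        1 - n%:R^-1 * \sum_(i < n) (y i < k.+1)%N%:R :> R.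
      apply: (mulfI n1); rewrite mulrBr mulr1 !mulrA divff// !mul1r.
      have -> : n%:R = \sum_(i < n) 1 :> R by rewrite sumr_const card_ord.
      rewrite -sumrB; apply: eq_bigr => i _.
      have -> : (y i < k.+1)%N = ~~ (k < y i)%N by rewrite ltnS leqNgt.
      by case: (k < y i)%N; rewrite ?subr0 ?subrr.
    have := hcdf k; have := g0 k; have := g1 k; nra.
  rewrite ler_pM2l ?invr_gt0 ?ltr0n//; apply: ler_sum => i _.
  exact: sum_trunc_le.
apply: lt_le_trans hsum; rewrite -/g in hdelta.
by move: Keps; rewrite -natr1; lra.
Qed.

(** With mean 0 all observations would be 0 and both sides of the strict inequality would vanish. *)
Lemma sample_mean_gt0 (nu : R) : 0 < nu ->
  nu * (ln (nu + sample_mean y) - ln nu) <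
    n%:R^-1 * \sum_(i < n) \sum_(j < y i) (nu / (nu + j%:R)) ->
  0 < sample_mean y :> R.
Proof.
move=> nu0 h.
have : 0 <= sample_mean y :> R by rewrite mulr_ge0 ?invr_ge0// sumr_ge0.
rewrite le_eqVlt => /predU1P[m0|//]; move: h; rewrite -m0 addr0 subrr mulr0.
have [n0|n0] := posnP n.
  have nV0 : n%:R^-1 = 0 :> R by rewrite n0 invr0.
  by rewrite nV0 mul0r ltxx.
move/esym/eqP: m0; rewrite mulf_eq0 invr_eq0 pnatr_eq0 -[n == 0%N]negbK -lt0n n0/=.
rewrite psumr_eq0// => /allP y0.
rewrite big1 ?mulr0 ?ltxx// => i _.
have /= := y0 i (mem_index_enum i); rewrite pnatr_eq0 => /eqP ->.
by rewrite big_ord0.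
Qed.

End empirical_score.

Theorem theorem3p4 (R : realType) (d : measure_display)
    (T : measurableType d) (P : probability T R)
    (lambda : R) (hlambda : 0 < lambda)
    (Y : nat -> {RV P >-> nat})
    (hindep : mutually_independent Y)
    (hpoisson : forall i, has_pmf (Y i) (poisson_pmf lambda))
    (numax : R) (hnumax : 0 < numax) :
  {ae P, forall w, \forall n \near \oo,
    let y := fun i : 'I_n => Y i w in
    nb_mle numax y = [set (numax, numax / (numax + sample_mean y))]}.
Proof.
have [K [delta delta0 hscore]] := poi_score_gt0 lambda numax hlambda hnumax.
(* [K.+2] leaves room for [K.+1] errors strictly below [delta]. *)
pose eps := delta / K.+2%:R.
have eps0 : 0 < eps by rewrite divr_gt0.
have Keps : K.+1%:R * eps < delta.
  by rewrite mulrCA gtr_pMr// ltr_pdivrMr// mul1r ltr_nat.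
have hmean := ae_sample_mean_lt d T P lambda hlambda Y hindep hpoisson eps eps0.
(* There are finitely many thresholds, so the exceptional null sets can be merged, and likewise the
   ranks below. *)
have hcdf : {ae P, forall w, forall k : 'I_K, \forall n \near \oo,
    n%:R^-1 * \sum_(i < n) (Y i w < k.+1)%N%:R < poi_cdf lambda k.+1 + eps}.
  by apply: filter_forall => k; exact: ae_cdf_lt.
apply: filterS2 hmean hcdf => w meanw cdfw.
near=> n.
have n0 : (0 < n)%N by near: n; exists 1%N.
have meann : sample_mean (fun i : 'I_n => Y i w) < lambda + eps by near: n.
have cdfn (k : 'I_K) : n%:R^-1 * \sum_(i < n) (Y i w < k.+1)%N%:R <
    poi_cdf lambda k.+1 + eps.
  by move: k; near: n; apply: filter_forall.
pose y := fun i : 'I_n => Y i w.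
have hs nu : 0 < nu -> nu <= numax ->
    nu * (ln (nu + sample_mean y) - ln nu) <
    n%:R^-1 * \sum_(i < n) \sum_(j < y i) (nu / (nu + j%:R)).
  move=> nu0 num; apply: (empirical_score_gt0 _ _ lambda delta eps nu K) => //.
  exact: hscore.
apply: (nb_mle_numax _ y) => //.
exact: (sample_mean_gt0 _ _ numax hnumax (hs _ hnumax (lexx _))).
Unshelve. all: by end_near. Qed.
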